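(* Let $G=(V,E)$ be a finite simple graph and let $d$ be a nonnegative integer. Then the number $P_d$ of parity-closed walks of length $d$ in $G$ satisfies $$P_d=2^{-|E|}\sum_{\pi\in\Pi}\mathrm{S}_d(G_\pi).$$
   Context: A sign function on $G$ is a map $\pi:E\to\{\pm1\}$, and $\Pi$ is the set of all sign functions on $E$. The signed graph $G_\pi$ has signed adjacency matrix $A(G_\pi)$ whose $(u,v)$ entry is $\pi(\{u,v\})$ if $\{u,v\}\in E$ and $0$ otherwise; $\mathrm{S}_d(G_\pi)=\mathrm{trace}(A(G_\pi)^d)$ is its $d$-th spectral moment. A closed walk of length $d$ is a sequence of vertices $(v_0,\ldots,v_d)$ with $v_d=v_0$ and $\{v_{t-1},v_t\}\in E$ for all $t$; it uses an edge $e$ as many times as there are indices $t$ with $\{v_{t-1},v_t\}=e$. A closed walk is parity-closed if it uses every edge of $G$ an even number of times (possibly zero). *)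

(* Defs.v *)
From mathcomp Require Import all_boot all_order all_algebra.

Set Implicit Arguments.
Unset Strict Implicit.
Unset Printing Implicit Defensive.

Import GRing.Theory.
Local Open Scope ring_scope.

(* Edges are unordered pairs, encoded as two-element vertex sets; in
   particular [set u; u] is never an edge. *)
Record simple_graph := SimpleGraph {
  vertex :> finType;
  edges : {set {set vertex}};
  card_edge : forall e, e \in edges -> #|e| = 2%N
}.

Section SignedGraphs.
Variable G : simple_graph.

Definition edge : finType := {e : {set G} | e \in edges G}.

Definition sign : finType := seq_sub [:: 1; -1 : int].

Definition sign_function : finType := {ffun edge -> sign}.

(* Rows and columns are indexed by 'I_#|G| through the enumeration of the
   vertices; insub s is None exactly when s is not an edge. *)
Definition signed_adjacency (pi : sign_function) : 'M[int]_#|G| :=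
  \matrix_(i, j)
    if insub [set enum_val i; enum_val j] is Some e then ssval (pi e) else 0.

Definition spectral_moment (d : nat) (pi : sign_function) : int :=
  \tr (signed_adjacency pi ^+ d).

Section Walks.
Variable d : nat.
Implicit Types w : d.+1.-tuple G.

(* With w = (v_0, ..., v_d), this is {v_t, v_(t+1)} for 0 <= t < d. *)
Definition step w (t : 'I_d) : {set G} :=
  [set tnth w (widen_ord (leqnSn d) t); tnth w (lift ord0 t)].

Definition closed_walk w : bool :=
  (tnth w ord_max == tnth w ord0) && [forall t, step w t \in edges G].

Definition edge_uses w (e : {set G}) : nat := #|[set t | step w t == e]|.

Definition parity_closed w : bool :=
  closed_walk w && [forall e in edges G, ~~ odd (edge_uses w e)].

Definition num_parity_closed : nat := #|[set w | parity_closed w]|.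

End Walks.
End SignedGraphs.

(* Main.v *)
(** Expanding the trace writes the [d]-th moment as a sum, over closed
    sequences of vertices, of products of edge signs.  Averaged over all sign
    functions, the contribution of a closed walk factors over the edges: an edge
    used [k] times contributes [(1 ^ k + (-1) ^ k) / 2], which is [1] for even
    [k] and [0] for odd [k]. *)
Require Import Defs.
From mathcomp Require Import all_boot all_order all_algebra.

Import GRing.Theory.
Local Open Scope ring_scope.

Lemma big_tuple_cons (R : nmodType) (T : finType) (n : nat)
    (P : pred (n.+1.-tuple T)) (F : n.+1.-tuple T -> R) :
  \sum_(w | P w) F w =
  \sum_(x : T) \sum_(w : n.-tuple T | P [tuple of x :: w]) F [tuple of x :: w].
Proof.
rewrite pair_big_dep /=.
rewrite (reindex (fun p : T * n.-tuple T => [tuple of p.1 :: p.2])) //=.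
exists (fun w => (thead w, [tuple of behead w])) => [[x w] _|w _] /=.
  by congr pair; apply: val_inj.
by rewrite -tuple_eta.
Qed.

(** Induction on [d] with [u] general: in [A ^+ d.+1 = A * A ^+ d], the inner index of the matrix
    product is the second vertex of the sequence. Since [f] is arbitrary, all vertex sequences are
    allowed, and non-adjacent steps can be given weight 0. *)
Lemma expmx_walkE (R : comPzRingType) (T : finType) (f : T -> T -> R)
    (d : nat) (u v : T) :
  ((\matrix_(i, j) f (enum_val i) (enum_val j) : 'M[R]_#|T|) ^+ d)
    (enum_rank u) (enum_rank v) =
  \sum_(w : d.+1.-tuple T | (tnth w ord0 == u) && (tnth w ord_max == v))
    \prod_(t < d) f (tnth w (widen_ord (leqnSn d) t)) (tnth w (lift ord0 t)).
Proof.
elim: d u => [|d IHd] u.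
  rewrite expr0 mxE (inj_eq enum_rank_inj).
  rewrite (reindex (fun x => [tuple x])) /=; last first.
    exists (fun w => thead w) => [x _ //|w _].
    by case/tupleP: w => x w; rewrite (tuple0 w); apply: val_inj.
  case: eqVneq => [<-|neq_uv].
    by rewrite (big_pred1 u) ?big_ord0 // => x; rewrite !(tnth_nth u) /= andbb.
  rewrite big_pred0 // => x; rewrite !(tnth_nth u) /=.
  by apply: contraNF neq_uv => /andP[/eqP-> /eqP->].
rewrite exprS mxE (reindex (@enum_rank T)) /=; last exact/onW_bij/enum_rank_bij.
rewrite big_tuple_cons [RHS](bigD1 u) //= [X in _ + X]big1 ?addr0; last first.
  move=> x neq_xu; apply: big_pred0 => w.
  by rewrite (tnth_nth u) /= (negPf neq_xu).
(* The head is now fixed to [u]; sorting the tails by their first vertex matches the inner index of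
   the product. *)
rewrite [RHS](partition_big (fun w : d.+1.-tuple T => tnth w ord0) predT) //=.
apply: eq_bigr => x _; rewrite mxE !enum_rankK IHd big_distrr /=.
apply: eq_big => [w|w /andP[/eqP w0 _]].
  by rewrite !(tnth_nth u) /= eqxx andbC.
rewrite big_ord_recl -w0 !(tnth_nth u) /=; congr (_ * _).
by apply: eq_bigr => t _; rewrite !(tnth_nth u).
Qed.

Lemma mxtrace_exp_walkE (R : comPzRingType) (T : finType) (f : T -> T -> R)
    (d : nat) :
  \tr ((\matrix_(i, j) f (enum_val i) (enum_val j) : 'M[R]_#|T|) ^+ d) =
  \sum_(w : d.+1.-tuple T | tnth w ord_max == tnth w ord0)
    \prod_(t < d) f (tnth w (widen_ord (leqnSn d) t)) (tnth w (lift ord0 t)).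
Proof.
rewrite /mxtrace (reindex (@enum_rank T)) /=; last exact/onW_bij/enum_rank_bij.
rewrite [RHS](partition_big (fun w : d.+1.-tuple T => tnth w ord0) predT) //=.
apply: eq_bigr => x _; rewrite expmx_walkE; apply: eq_bigl => w.
by rewrite andbC; case: (eqVneq (tnth w ord0) x) => [->|]; rewrite ?andbF.
Qed.

Lemma sum_sign_exp (k : nat) :
  \sum_(s : sign) ssval s ^+ k = if odd k then 0 else 2 :> int.
Proof.
pose sp : sign := SeqSub (mem_head 1 [:: -1 : int]).
have m1P : -1 \in [:: 1; -1 : int] by rewrite !inE eqxx orbT.
pose sm : sign := SeqSub m1P.
rewrite (bigD1 sp) // (bigD1 sm) //= big1 ?addr0 => [|s /andP[]].
  by rewrite expr1n -signr_odd; case: odd; rewrite ?expr1 ?expr0 ?subrr.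
(* There is no third sign, so the remaining sum is empty. *)
by rewrite -!val_eqE /=; have := ssvalP s; rewrite !inE => /orP[] ->.
Qed.

Lemma sum_sign_walk (G : simple_graph) (d : nat) (w : d.+1.-tuple G) :
  (forall t, step w t \in edges G) ->
  \sum_(pi : sign_function G)
    \prod_(t < d) (if insub (step w t) is Some e then ssval (pi e) else 0) =
  if [forall e in edges G, ~~ odd (edge_uses w e)] then 2 ^+ #|edges G|
  else 0 :> int.
Proof.
move=> w_edge.
pose st t : edge G := Sub (step w t) (w_edge t).
transitivity (\sum_(pi : sign_function G)
    \prod_(e : edge G) ssval (pi e) ^+ edge_uses w (val e)).
  apply: eq_bigr => pi _.
  (* Grouping the steps by the edge they traverse turns repeated factors into powers. *)
  rewrite (partition_big st predT) //=; apply: eq_bigr => e _.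
  rewrite (eq_big (fun t => t \in [set t | step w t == val e])
    (fun=> ssval (pi e))) /=.
  - by rewrite prodr_const.
  - by move=> t; rewrite inE -val_eqE.
  by move=> t /eqP <-; rewrite -[step w t]/(val (st t)) valK.
(* Signs of distinct edges are chosen independently, so distributivity, read backwards, turns the
   sum of products into a product over edges of two-term sums. *)
rewrite -(bigA_distr_bigA (fun (e : edge G) (s : sign) =>
  ssval s ^+ edge_uses w (val e))) /=.
case: ifPn => [/forall_inP even_uses|/forall_inPn[e eG /negbNE odd_e]].
  rewrite (eq_bigr (fun=> 2)) => [|e _]; first by rewrite prodr_const card_sig.
  by rewrite sum_sign_exp (negPf (even_uses _ (valP e))).
by rewrite (bigD1 (Sub e eG : edge G)) //= sum_sign_exp odd_e mul0r.
Qed.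

Lemma sum_spectral_moment (G : simple_graph) (d : nat) :
  \sum_(pi : sign_function G) spectral_moment d pi =
  2 ^+ #|edges G| *+ num_parity_closed G d :> int.
Proof.
transitivity (\sum_(pi : sign_function G)
  \sum_(w : d.+1.-tuple G | tnth w ord_max == tnth w ord0)
    \prod_(t < d) (if insub (step w t) is Some e then ssval (pi e) else 0)).
  apply: eq_bigr => pi _.
  exact: (mxtrace_exp_walkE _ _ (fun u v : G =>
    if insub [set u; v] is Some e then ssval (pi e) else 0)).
rewrite exchange_big /= -sumr_const.
rewrite [RHS](eq_bigl (fun w => parity_closed w)) => [|w]; last by rewrite inE.
rewrite big_mkcond [RHS]big_mkcond; apply: eq_bigr => w _.
rewrite /parity_closed /closed_walk; case: eqP => //= _.
case: (boolP [forall t, _]) => [/forallP|/forallPn[t]] w_edge.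
  exact: (@sum_sign_walk G d w).
(* Here step [t] is not an edge, so its factor is the default 0 for every [pi]. *)
apply: big1 => pi _; rewrite (bigD1 t) //= insubN ?mul0r //.
Qed.

Theorem theorem3p1 (G : simple_graph) (d : nat) :
  (num_parity_closed G d)%:R =
  2%:R ^- #|edges G| *
    \sum_(pi : sign_function G) (spectral_moment d pi)%:~R :> rat.
Proof.
rewrite -(rmorph_sum intr) sum_spectral_moment rmorphMn rmorphXn /=.
by rewrite -[X in _ * X]mulr_natr mulKf // expf_neq0.
Qed.
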